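(* Let $S\leq T(X)$ with $FI(X)\subseteq S$. Then the following statements are equivalent: (i) $S$ is a maximal subsemigroup of $T(X)$. (ii) $S=T(X)\setminus H$ for some $H\in\mathcal{H}(C_p(X)\cap Sur(X),FI(X))$.
   Context: $X$ is a countably infinite set (one may take $X=\mathbb{N}$) and $T(X)$ is the monoid of all full transformations (maps $X\to X$) under composition. $A\leq B$ means that $A$ is a subsemigroup of $B$; $\langle A\rangle$ is the subsemigroup generated by $A$. A subsemigroup $S$ of $T(X)$ is maximal if $S\neq T(X)$ and there is no subsemigroup of $T(X)$ lying strictly between $S$ and $T(X)$. For $\alpha\in T(X)$: $im\,\alpha$ is its range, $rank(\alpha)=|im\,\alpha|$, the defect is $d(\alpha)=|X\setminus im\,\alpha|$, the collapse is $c(\alpha)=\sum_{y\in im\,\alpha}(|y\alpha^{-1}|-1)$, where $y\alpha^{-1}$ is the preimage of $y$, and the infinite contractive index is $k(\alpha)=|\{x\in im\,\alpha\mid |x\alpha^{-1}|=\aleph_0\}|$. $Sur(X)=\{\alpha\in T(X)\mid rank(\alpha)=\aleph_0,\ c(\alpha)\neq 0,\ d(\alpha)=0\}$; $C_p(X)=\{\alpha\in T(X)\mid rank(\alpha)=\aleph_0,\ k(\alpha)=\aleph_0\}$; $FI(X)=\{\alpha\in T(X)\mid rank(\alpha)=\aleph_0,\ d(\alpha)=\aleph_0,\ c(\alpha)<\aleph_0\}$ (a subsemigroup of $T(X)$). For a set $M$ of subsets of $T(X)$, let $J(M)$ be the set of all $A\subseteq T(X)$ such that: $A\subseteq\bigcup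 M=\{a\mid \exists m\in M,\ a\in m\}$; $A\cap m\neq\emptyset$ for all $m\in M$; and for every $\alpha\in A$ there exists $m\in M$ with $A\cap m=\{\alpha\}$. For $U\subseteq T(X)$ and $W\leq T(X)$ put $Gen(U)=\{A\subseteq T(X)\mid A \text{ is finite and } \langle A\rangle\cap U\neq\emptyset\}$ and $\mathcal{H}(U,W)=\{A\subseteq T(X)\setminus W\mid A\in J(Gen(U))\}$. *)

(* Defs.v *)
From HB Require Import structures.
From mathcomp Require Import all_boot.
From mathcomp Require Import boolp classical_sets functions cardinality.
Set Implicit Arguments.
Unset Strict Implicit.
Unset Printing Implicit Defensive.
Local Open Scope classical_set_scope.
Local Open Scope card_scope.

(* Cardinal invariants are represented by sets having that cardinal: for a set
   [A], "|A| = aleph_0" is [A #= [set: nat]], "|A| = 0" is [A #= set0] and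
   "|A| < aleph_0" is [finite_set A]. *)

(* [\o] composes in the opposite order to maps written on the right of their
   arguments; being a subsemigroup does not depend on that order. As usual for
   closure systems the empty set counts as a subsemigroup, so that the
   subsemigroup generated by the empty set is empty. *)
Definition subsemigroup (X : Type) (S : set (X -> X)) : Prop :=
  forall a b : X -> X, S a -> S b -> S (a \o b).

Definition gen_subsemigroup (X : Type) (A : set (X -> X)) : set (X -> X) :=
  smallest (@subsemigroup X) A.

Definition maximal_subsemigroup (X : Type) (S : set (X -> X)) : Prop :=
  [/\ subsemigroup S,
      S <> [set: X -> X] &
      ~ exists B : set (X -> X),
          [/\ subsemigroup B, S `<` B & B `<` [set: X -> X]]].

Definition fiber (X : Type) (a : X -> X) (y : X) : set X := a @^-1` [set y].

Definition defect (X : Type) (a : X -> X) : set X := ~` range a.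

(* A fiber with one chosen point removed; for [y] in the range of [a] its
   cardinal is |fiber a y| - 1. *)
Definition pointed_fiber_rest (X : choiceType) (a : X -> X) (y : X) : set X :=
  fiber a y `\ xget y (fiber a y).

(* The cardinal sum of the |fiber a y| - 1 for [y] in the range of [a], i.e. the
   disjoint union of these sets, as a set of pairs [(y, x)]. *)
Definition collapse (X : choiceType) (a : X -> X) : set (X * X) :=
  range a `*`` pointed_fiber_rest a.

Definition contractive_index (X : Type) (a : X -> X) : set X :=
  [set x | range a x /\ fiber a x #= [set: nat]].

Definition Sur (X : choiceType) : set (X -> X) :=
  [set a | [/\ range a #= [set: nat],
               ~ (collapse a #= @set0 (X * X)) &
               defect a #= @set0 X]].

Definition Cp (X : Type) : set (X -> X) :=
  [set a | range a #= [set: nat] /\ contractive_index a #= [set: nat]].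

Definition FI (X : choiceType) : set (X -> X) :=
  [set a | [/\ range a #= [set: nat],
               defect a #= [set: nat] &
               finite_set (collapse a)]].

Definition J (T : Type) (M : set (set T)) : set (set T) :=
  [set A | [/\ A `<=` \bigcup_(m in M) m,
               forall m : set T, M m -> A `&` m !=set0 &
               forall a : T, A a -> exists2 m : set T, M m & A `&` m = [set a]]].

Definition Gen (X : Type) (U : set (X -> X)) : set (set (X -> X)) :=
  [set A | finite_set A /\ gen_subsemigroup A `&` U !=set0].

Definition calH (X : Type) (U W : set (X -> X)) : set (set (X -> X)) :=
  [set A | A `<=` ~` W /\ J (Gen U) A].

(* Main.v *)
(** Every map is [u \o phi \o u \o f] for suitable injections [phi], [f] of
    infinite co-range, as soon as [u] is a surjection with infinitely many
    infinite fibres. Indeed [phi] can be chosen to make all fibres of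
    [u \o phi \o u] infinite: choose distinct points [g x] with infinite fibres
    under [u] and a section [s] of [u], and let [phi] extend [g x |-> s x], so
    that the fibre over [x] contains that of [u] over [g x]. A map [a] then lifts
    through any surjection [w] with infinite fibres, as [a = w \o f], choosing
    [f x] in the fibre of [w] over [a x] with room to spare for injectivity.
    Consequently a subsemigroup containing [FI X] is proper exactly when it
    misses [Cp X `&` Sur X], and both implications follow since membership in a
    generated subsemigroup involves finitely many generators. *)
Require Import Defs.
From mathcomp Require Import all_boot.
From mathcomp Require Import boolp classical_sets functions cardinality.
Local Open Scope classical_set_scope.
Local Open Scope card_scope.

Lemma card_nat_infinite (T : Type) (A : set T) :
  A #= [set: nat] -> infinite_set A.
Proof. by move=> /eq_finite_set ->; exact: infinite_nat. Qed.

Lemma infinite_set_seq (T : Type) (A : set T) :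
  infinite_set A -> exists2 e : nat -> T, injective e & forall n, A (e n).
Proof.
move=> /infiniteP /card_leP [f].
exists (fun n => set_val (f (to_setT n))) => [n m /val_inj E|n];
  last exact: set_valP.
have : to_setT n = to_setT m by apply: (@inj _ _ _ f) E; rewrite inE.
by move=> /(congr1 set_val).
Qed.

Lemma infinite_set_inj (T : Type) (A : set T) (e : nat -> T) :
  injective e -> (forall n, A (e n)) -> infinite_set A.
Proof.
move=> e_inj Ae; apply: (@sub_infinite_set _ (range e)) => [_ [n _ <-] //|].
apply: card_nat_infinite; apply: inj_card_eq; exact: in2W.
Qed.

Lemma card_nat_set (X : Type) (A : set X) :
  [set: X] #= [set: nat] -> infinite_set A -> A #= [set: nat].
Proof.
move=> hX; apply: eq_card_nat; apply: (@sub_countable _ _ _ [set: X]).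
  by apply: subset_card_le.
by rewrite (eq_countable hX).
Qed.

Lemma injective_FI (X : choiceType) (f : X -> X) : [set: X] #= [set: nat] ->
  injective f -> infinite_set (defect f) -> @FI X f.
Proof.
move=> hX f_inj df; split; last 1 first.
(* The point that [xget] picks in a nonempty fibre lies in that fibre, so by injectivity it is the
   whole fibre and nothing is left over. *)
- rewrite (_ : collapse f = set0) // -subset0 => -[y x] /= [[z _ <-]] [/= fx].
  apply; apply: f_inj; rewrite fx; apply/esym.
  by apply: (@xgetPex _ _ (fiber f (f z))); exists z.
- apply: (card_eq_trans _ hX); apply: inj_card_eq; exact: in2W.
- exact: card_nat_set.
Qed.

Lemma lift_infinite_fibers (X : choiceType) (w a : X -> X) :
  [set: X] #= [set: nat] -> (forall y, infinite_set (fiber w y)) ->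
  exists2 f, @FI X f & a = w \o f.
Proof.
move=> hX w_inf.
have /countable_injP[c /(@in2TT _ _ _) c_inj] : countable [set: X].
  by rewrite (eq_countable hX).
have /choice[e eP] y : exists e : nat -> X,
    injective e /\ forall n, w (e n) = y.
  by have [e] := infinite_set_seq _ _ (w_inf y); exists e.
have e_inj y y' n n' : e y n = e y' n' -> y = y' /\ n = n'.
  move=> E; have yy' : y = y' by rewrite -((eP y).2 n) E (eP y').2.
  by move: E; rewrite -yy' => /(eP y).1.
(* The index [(c x).*2] separates points with equal image under [a]; the odd indices stay free, and
   those over a single point [a x0] already make the defect infinite. *)
exists (fun x => e (a x) (c x).*2); last first.
  by apply/funext => x /=; rewrite (eP _).2.
apply: injective_FI => // [x x' /e_inj[_ /double_inj/c_inj] //|].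
have [x0 _] := infinite_setN0 (card_nat_infinite _ _ hX).
apply: (@infinite_set_inj _ _ (fun n => e (a x0) n.*2.+1)).
  by move=> n m /(eP _).1 [] /double_inj.
by move=> n [x _ /e_inj[_ E]]; have := congr1 odd E; rewrite /= !odd_double.
Qed.

Lemma infinite_fibers_comp (X : choiceType) (u : X -> X) :
  [set: X] #= [set: nat] -> Cp u -> Sur u ->
  exists2 phi, @FI X phi & forall y, infinite_set (fiber (u \o phi \o u) y).
Proof.
move=> hX [_ cu] [_ _]; rewrite card_eq0 => /eqP du.
have /countable_injP[c /(@in2TT _ _ _) c_inj] : countable [set: X].
  by rewrite (eq_countable hX).
have /choice[s us] y : exists x, u x = y.
  apply: contrapT => nu; suff : set0 y by [].
  by rewrite -du => -[x _ ux]; apply: nu; exists x.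
have [t t_inj tP] := infinite_set_seq _ _ (card_nat_infinite _ _ cu).
pose w := t 0.
(* The fibre over [w] is a reservoir for the values of [phi] off [range g]. Since [s] has one value
   in each fibre of [u], removing [s w] keeps the reservoir disjoint from [range s]. *)
have [e e_inj eP] : exists2 e : nat -> X, injective e &
    forall n, (fiber u w `\ s w) (e n).
  apply: infinite_set_seq; apply: infinite_setD; last exact: finite_set1.
  exact: card_nat_infinite (tP 0).2.
pose g x := t (c x).
have g_inj : injective g by move=> x y /t_inj/c_inj.
have s_inj : injective s by move=> x y /(congr1 u); rewrite !us.
have s_e x n : s x <> e n.
  by move=> E; case: (eP n); rewrite -E /fiber /= us => -> [].
(* Only even indices of the reservoir are used, so that the points [e n.*2.+1] witness infinite
   defect. *)
have /choice[phi phiP] z : exists z',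
    (exists2 x, z = g x & z' = s x) \/ (~ range g z /\ z' = e (c z).*2).
  have [[x _ <-]|ngz] := pselect (range g z).
    by exists (s x); left; exists x.
  by exists (e (c z).*2); right.
have phig x : phi (g x) = s x.
  by case: (phiP (g x)) => [[y /g_inj -> ->]//|[[]]]; exists x.
exists phi.
  apply: injective_FI => // [z z'|].
    case: (phiP z) => [[x -> ->]|[_ ->]];
      case: (phiP z') => [[x' -> ->]|[_ ->]].
    - by move=> /s_inj ->.
    - by move=> /s_e.
    - by move=> /esym/s_e.
    - by move=> /e_inj/double_inj/c_inj.
  apply: (@infinite_set_inj _ _ (fun n => e n.*2.+1)) => [n m|n [z _]].
    by move=> /e_inj[]/double_inj.
  case: (phiP z) => [[x _ ->]/s_e//|[_ ->] /e_inj E].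
  by have := congr1 odd E; rewrite /= !odd_double.
move=> y; apply: sub_infinite_set (card_nat_infinite _ _ (tP (c y)).2) => z.
by rewrite /fiber /= => ->; rewrite -/(g y) phig us.
Qed.

Lemma FI_Cp_Sur_full (X : choiceType) (S : set (X -> X)) (u : X -> X) :
  [set: X] #= [set: nat] -> subsemigroup S -> @FI X `<=` S -> S u ->
  (@Cp X `&` @Sur X) u -> S = [set: X -> X].
Proof.
move=> hX hS FIS Su [Cu Suru]; apply/seteqP; split=> // a _.
have [phi FIphi w_inf] := infinite_fibers_comp _ _ hX Cu Suru.
have [f FIf ->] := lift_infinite_fibers _ _ a hX w_inf.
exact: (hS _ _ (hS _ _ (hS _ _ Su (FIS _ FIphi)) Su) (FIS _ FIf)).
Qed.

(** A bijection of [X] with [X * nat], followed by the first projection, is a surjection all of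
    whose fibres are infinite. *)
Lemma Cp_Sur_nonempty (X : choiceType) :
  [set: X] #= [set: nat] -> (@Cp X `&` @Sur X) !=set0.
Proof.
move=> hX.
have /card_bijP[h [k hk kh]] : [set: X] #= [set: X * nat].
  apply: (card_eq_trans hX); rewrite card_eq_sym.
  rewrite (_ : setT = [set: X] `*`` fun=> [set: nat]); last exact/esym/seteqP.
  by apply: (cardXR_eq_nat hX) => _; split => //; exists 0.
pose p x := set_val (h (to_setT x)); pose q z := set_val (k (to_setT z)).
have qK : cancel q p.
  move=> z; rewrite /p /q; set t := k _.
  by rewrite (_ : to_setT _ = t) ?kh //; apply: val_inj.
pose u x := (p x).1.
have u_inf y : infinite_set (fiber u y).
  apply: (@infinite_set_inj _ _ (fun n => q (y, n))) => [n m|n].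
    by move=> /(congr1 p); rewrite !qK => -[].
  by rewrite /fiber /u /= qK.
have rangeu : range u = [set: X].
  by apply/seteqP; split => // y _; exists (q (y, 0)); rewrite // /u qK.
exists u; split; split; rewrite ?rangeu //.
- rewrite (_ : contractive_index u = [set: X]) //.
  apply/seteqP; split => // y _; split; first by rewrite rangeu.
  exact: card_nat_set.
- rewrite card_eq0 => /eqP c0.
  have [y _] := infinite_setN0 (card_nat_infinite _ _ hX).
  have [x xP] := infinite_setN0
    (infinite_setD (u_inf y) (finite_set1 (xget y (fiber u y)))).
  suff : @set0 (X * X) (y, x) by [].
  by rewrite -c0; split; rewrite ?rangeu.
- by rewrite card_eq0 /defect rangeu setCT.
Qed.

Lemma gen_subsemigroupP (X : Type) (A : set (X -> X)) :
  subsemigroup (gen_subsemigroup A).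
Proof.
move=> b c Ab Ac D hD; exact: (hD.1 _ _ (Ab _ hD) (Ac _ hD)).
Qed.

(** The maps generated by finite subsets of [A] are closed under composition, because two finite
    subsets have a finite union. This supplies the finite sets that [Gen] asks for. *)
Lemma gen_subsemigroup_finite (X : Type) (A : set (X -> X)) a :
  gen_subsemigroup A a ->
  exists m, [/\ finite_set m, m `<=` A & gen_subsemigroup m a].
Proof.
pose P := [set b | exists m,
  [/\ finite_set m, m `<=` A & gen_subsemigroup m b]].
suff : gen_subsemigroup A `<=` P by apply.
apply: smallest_sub => [b c [m [fm mA mb]] [n [fn nA nc]]|b Ab].
  exists (m `|` n); split; first by rewrite finite_setU.
    by rewrite subUset.
  apply: gen_subsemigroupP.
    by apply: sub_smallest2r mb; [exact: gen_subsemigroupP|exact: subsetUl].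
  by apply: sub_smallest2r nc; [exact: gen_subsemigroupP|exact: subsetUr].
exists [set b]; split; first exact: finite_set1.
  by move=> _ ->.
exact: sub_gen_smallest.
Qed.

Theorem proposition13 (X : choiceType) (hX : [set: X] #= [set: nat])
  (S : set (X -> X)) (hS : subsemigroup S) (hFI : @FI X `<=` S) :
  maximal_subsemigroup S <->
  exists2 H : set (X -> X), calH (@Cp X `&` @Sur X) (@FI X) H & S = ~` H.
Proof.
have gen_sub (A : set (X -> X)) : A `<=` gen_subsemigroup A.
  exact: sub_gen_smallest.
have [u0 Uu0] := Cp_Sur_nonempty _ hX.
split=> [[_ SnT Smax]|[H [HFI [_ Hmeet Hcrit]] SE]].
- have gen_extend a : ~ S a -> gen_subsemigroup (a |` S) = [set: X -> X].
    move=> nSa; apply: contrapT => nT; apply: Smax.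
    exists (gen_subsemigroup (a |` S)); split; first exact: gen_subsemigroupP.
      split=> [|sub]; first exact: subset_trans (@subsetUr _ _ _) (gen_sub _).
      by apply: nSa; apply: sub; apply: gen_sub; left.
    by split=> // sub; apply: nT; apply/seteqP.
  have crit a : ~ S a -> exists2 m,
      Gen (@Cp X `&` @Sur X) m & ~` S `&` m = [set a].
    move=> nSa; have := I : [set: X -> X] u0; rewrite -(gen_extend a nSa).
    move=> /gen_subsemigroup_finite[m [fm mS mu]].
    (* All elements of [m] outside [S] equal [a], but [m] need not contain [a]; adding it makes the
       trace on the complement exactly [[set a]]. *)
    exists (a |` m).
      split; first by rewrite finite_setU; split=> //; exact: finite_set1.
      exists u0; split=> //.
      by apply: sub_smallest2r mu; [exact: gen_subsemigroupP|exact: subsetUr].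
    apply/seteqP; split=> [b [nSb [//|/mS[]//]]|_ ->]; split=> //.
    by left.
  exists (~` S); last by rewrite setCK.
  split; first by move=> a nSa /hFI.
  split=> [a nSa|m [_ [u [mu Uu]]]|]; last exact: crit.
    have [m Gm mE] := crit a nSa; exists m => //.
    by have [] : (~` S `&` m) a by rewrite mE.
  (* A member of [Gen] that misses the complement lies in [S], which would then contain [u] and be
     everything. *)
  apply: contrapT => nm; apply: SnT; apply: (@FI_Cp_Sur_full X S u) => //.
  apply: mu; split=> // b mb; apply: contrapT => nSb; by apply: nm; exists b.
- split=> //.
    (* The singleton of [u0] belongs to [Gen], so [H] meets it and is nonempty. *)
    have [|a [Ha _]] := Hmeet [set u0].
      split; first exact: finite_set1.
      by exists u0; split=> //; apply: sub_gen_smallest.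
    by move=> ST; have : [set: X -> X] a by []; rewrite -ST SE; apply.
  move=> [B [hB [SB nBS] [_ nTB]]].
  have [a Ba nSa] : exists2 a, B a & ~ S a.
    apply: contrapT => nB; apply: nBS => a Ba; apply: contrapT => nSa.
    by apply: nB; exists a.
  have Ha : H a by apply: contrapT => nHa; apply: nSa; rewrite SE.
  have [m [_ [u [mu Uu]]] mE] := Hcrit a Ha.
  apply: nTB; suff -> : B = [set: X -> X] by [].
  apply: (@FI_Cp_Sur_full X B u) => //; first exact: subset_trans SB.
  (* The only element of [m] in [H] is [a], which lies in [B]; the others lie in [S], hence in
     [B]. *)
  apply: mu; split=> // b mb.
  have [Hb|nHb] := pselect (H b); last by apply: SB; rewrite SE.
  suff -> : b = a by [].
  by have : (H `&` m) b by []; rewrite mE.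
Qed.
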